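(* For every positive integer $k$, the graph $G_k$ (defined in the context) has degeneracy $3^k-1$ and localization number $\zeta(G_k)=k$.
   Context: Construction of $G_k$: let $k$ be a positive integer. Begin with the $k$-fold strong product of copies of the cycle $C_{40}$: its vertices, called core vertices, are the vectors $(w_1,\dots,w_k)$ with entries in $\{0,1,\dots,39\}$, and two distinct core vertices are adjacent if and only if they differ by at most $1$ (modulo $40$) in every coordinate. Add $2k$ further vertices, called satellite vertices, $s_{i,t}$ for $i\in\{1,\dots,k\}$ and $t\in\{0,10\}$. For each $i$ and $t$, join $s_{i,t}$ by an edge to every core vertex whose $i$th coordinate equals $t$, and then subdivide each of these satellite-to-core edges into a path of length $40$ (i.e. replace it by a path with $40$ edges between the same endpoints, through $39$ new internal vertices, distinct paths having disjoint sets of internal vertices). The resulting graph is $G_k$. Degeneracy: the degeneracy of a graph $G$ is the maximum, over all (nonempty) subgraphs $H$ of $G$, of the minimum degree $\delta(H)$. Localization game: let $G$ be a finite, simple, undirected, connected graph and $m$ a positive integer. One player controls $m$ cops, the other controls an invisible robber. The robber first chooses a starting vertex $r_1$. In round $t=1,2,\dots$, the cops choose vertices $u_1,\dots,u_m$ of $G$ (arbitrarily; they are not restricted to moving to neighboring vertices, and the choice may depend on all earlier probes and their results) and learn the distance vector $(d_G(u_1,r_t),\dots,d_G(u_m,r_t))$; then the robber either stays or moves to a neighbor, so $r_{t+1}=r_t$ or $r_{t+1}$ is adjacent to $r_t$. The cops capture the robber in round $t$ if, after the probe of round $t$, the robber's current vertex $r_t$ is uniquely determined by the information the cops have received, i.e.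 all robber trajectories $r'_1,\dots,r'_t$ (consecutive vertices equal or adjacent) consistent with all the distance vectors received so far satisfy $r'_t=r_t$. The cops have a winning strategy if they have a strategy that captures the robber after finitely many rounds against every possible robber trajectory (equivalently, even a robber who knows the cops' entire strategy in advance). The robber wins if he is never captured. The localization number $\zeta(G)$ is the least positive integer $m$ for which $m$ cops have a winning strategy on $G$. *)

(* Defs.v *)
From mathcomp Require Import all_boot.

Set Implicit Arguments.
Unset Strict Implicit.
Unset Printing Implicit Defensive.

Record sgraph := SGraph {
  vertex :> finType;
  adj : rel vertex;
  adj_sym : symmetric adj;
  adj_irr : irreflexive adj }.

Definition connected (G : sgraph) : Prop := forall x y : G, connect (@adj G) x y.

Definition edges (G : sgraph) : {set {set G}} :=
  [set [set p.1; p.2] | p : G * G & adj p.1 p.2].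

(* A subgraph, not necessarily induced, is a pair (vertex set, edge set). *)
Definition is_subgraph (G : sgraph) (H : {set G} * {set {set G}}) : bool :=
  (H.2 \subset edges G) && [forall f in H.2, f \subset H.1].

Definition subdegree (G : sgraph) (H : {set G} * {set {set G}}) (x : G) : nat :=
  #|[set f in H.2 | x \in f]|.

(* Every degree is smaller than #|G|, so the default value #|G| does not
   affect the minimum when H has a vertex. *)
Definition min_degree (G : sgraph) (H : {set G} * {set {set G}}) : nat :=
  \big[minn/#|G|]_(x in H.1) subdegree H x.

Definition degeneracy (G : sgraph) : nat :=
  \max_(H : {set G} * {set {set G}} | is_subgraph H && (H.1 != set0))
     min_degree H.

(* Shortest paths have fewer than #|G| edges; in a disconnected graph, dist x y
   is #|G| when y is not reachable from x. *)
Definition dist (G : sgraph) (x y : G) : nat :=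
  find (fun n => [exists p : n.-tuple G, path (@adj G) x p && (last x p == y)])
       (iota 0 #|G|).

Section Game.

Variables (G : sgraph) (m : nat).

Definition distvec (u : m.-tuple G) (x : G) : m.-tuple nat :=
  [tuple dist (tnth u j) x | j < m].

Definition history := seq (m.-tuple G * m.-tuple nat).

Definition strategy := history -> m.-tuple G.

Definition robber_step (x y : G) : bool := (y == x) || adj x y.

(* Rounds are numbered from 0: r t is the position probed in round t. *)
Definition trajectory (r : nat -> G) : Prop :=
  forall t, robber_step (r t) (r t.+1).

(* The probes and results of the rounds before round t. *)
Fixpoint play (sigma : strategy) (r : nat -> G) (t : nat) : history :=
  if t is t'.+1 then
    let h := play sigma r t' in rcons h (sigma h, distvec (sigma h) (r t'))
  else [::].

Definition probe (sigma : strategy) (r : nat -> G) (t : nat) : m.-tuple G :=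
  sigma (play sigma r t).

(* r' only matters on rounds 0, ..., t. *)
Definition consistent (sigma : strategy) (r r' : nat -> G) (t : nat) : Prop :=
  (forall s, s < t -> robber_step (r' s) (r' s.+1)) /\
  (forall s, s <= t ->
     distvec (probe sigma r s) (r' s) = distvec (probe sigma r s) (r s)).

Definition captured (sigma : strategy) (r : nat -> G) (t : nat) : Prop :=
  forall r' : nat -> G, consistent sigma r r' t -> r' t = r t.

Definition cops_win : Prop :=
  exists sigma : strategy,
    forall r : nat -> G, trajectory r -> exists t, captured sigma r t.

End Game.

Definition is_localization_number (G : sgraph) (m : nat) : Prop :=
  [/\ 0 < m, cops_win G m &
      forall m', 0 < m' -> cops_win G m' -> m <= m'].

Section Construction.

Variable k : nat.

Definition core := {ffun 'I_k -> 'I_40}.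

Definition cyc_close (a b : 'I_40) : bool :=
  [|| a == b, b == ordS a | a == ordS b].

Definition core_adj (u v : core) : bool :=
  (u != v) && [forall i, cyc_close (u i) (v i)].

(* (i, false) is the satellite s_{i,0} and (i, true) is s_{i,10}. *)
Definition satellite := ('I_k * bool)%type.

Definition level (s : satellite) : nat := if s.2 then 10 else 0.

(* The satellite-to-core edges that are to be subdivided. *)
Definition leg :=
  {l : satellite * core | l.2 l.1.1 == level l.1 :> nat}.

(* (l, j) is the vertex at distance j + 1 from the satellite along the
   path replacing l. *)
Definition internal := (leg * 'I_39)%type.

Definition gk_vertex := (core + satellite + internal)%type.

Definition gk_arc (x y : gk_vertex) : bool :=
  match x, y with
  | inl (inl u), inl (inl v) => core_adj u v
  | inl (inr s), inr (l, j) => (s == (val l).1) && (j == 0 :> nat)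
  | inr (l, j), inr (l', j') => (l == l') && (j' == j.+1 :> nat)
  | inr (l, j), inl (inl w) => (w == (val l).2) && (j == 38 :> nat)
  | _, _ => false
  end.

Definition gk_adj (x y : gk_vertex) : bool := gk_arc x y || gk_arc y x.

Lemma gk_adj_sym : symmetric gk_adj.
Proof. by move=> x y; rewrite /gk_adj orbC. Qed.

Lemma gk_adj_irr : irreflexive gk_adj.
Proof.
move=> x; rewrite /gk_adj orbb; case: x => [[u|s]|[l j]] //=.
  by rewrite /core_adj eqxx.
by rewrite eqxx /=; apply/negbTE; rewrite neq_ltn ltnSn.
Qed.

Definition Gk : sgraph := SGraph gk_adj_sym gk_adj_irr.

Lemma Gk_connected : connected Gk.
Proof.
pose z : gk_vertex := inl (inl [ffun=> ord0]).
have csym : connect_sym gk_adj by apply: sym_connect_sym; exact: gk_adj_sym.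
suff cz (x : gk_vertex) : connect gk_adj x z.
  by move=> x y; apply: (connect_trans (cz x)); rewrite csym.
have ltsub (a : 'I_40) n : a - n < 40 by apply: leq_ltn_trans (leq_subr _ _) _.
have ccore (w : core) : connect gk_adj (inl (inl w)) z.
  pose sh n : core := [ffun i => Ordinal (ltsub (w i) n)].
  have shP n : connect gk_adj (inl (inl w)) (inl (inl (sh n))).
    elim: n => [|n IHn].
      suff -> : sh 0 = w by exact: connect0.
      by apply/ffunP=> i; apply: val_inj; rewrite ffunE /= subn0.
    apply: (connect_trans IHn).
    have [->|ne] := eqVneq (sh n) (sh n.+1); first exact: connect0.
    apply: connect1; rewrite /gk_adj /= /core_adj ne /=; apply/orP; left.
    apply/forallP=> i; rewrite /cyc_close !ffunE -!val_eqE /= subnS.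
    case: (w i - n) (ltsub (w i) n) => [|d] //= ltd.
    by rewrite (modn_small ltd) eqxx !orbT.
  have := shP 40; suff -> : sh 40 = [ffun=> ord0] by [].
  apply/ffunP=> i; apply: val_inj; rewrite !ffunE /=.
  by apply/eqP; rewrite subn_eq0 ltnW.
have cint (l : leg) d (j : 'I_39) : j + d = 38 -> connect gk_adj (inr (l, j)) z.
  elim: d j => [|d IHd] j.
    rewrite addn0 => j38; apply: connect_trans (ccore (val l).2).
    by apply: connect1; rewrite /gk_adj /= j38 !eqxx.
  move=> jd; have lej : j.+1 <= 38.
    by rewrite -[X in _ <= X]jd -addSnnS leq_addr.
  have ltj : j.+1 < 39 by [].
  apply: (connect_trans _ (IHd (Ordinal ltj) _)); last by rewrite -[RHS]jd /= addSnnS.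
  by apply: connect1; rewrite /gk_adj /= !eqxx.
case: x => [[w|s]|[l j]].
- exact: ccore.
- have lts : level s < 40 by rewrite /level; case: s.2.
  pose w : core := [ffun=> Ordinal lts].
  have lP : w s.1 == level s :> nat by rewrite ffunE.
  pose l : leg := exist _ (s, w) lP.
  apply: (connect_trans _ (@cint l 38 ord0 _)) => //.
  by apply: connect1; rewrite /gk_adj /= !eqxx.
by apply: (@cint l (38 - j)); rewrite subnKC // -ltnS ltn_ord.
Qed.

End Construction.

(* Main.v *)
Require Import Defs.
From mathcomp Require Import all_boot.
From mathcomp Require Import zify.

Set Implicit Arguments.
Unset Strict Implicit.
Unset Printing Implicit Defensive.

(** Why the theorem holds.

    Degeneracy.  The core is regular of degree 3 ^ k - 1.  Conversely, any
    nonempty vertex set has a vertex of at most that degree inside the set: an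
    interior vertex of a subdivided edge has degree 2, a satellite has no
    neighbour left once there are no interior vertices, and otherwise the set
    lies in the core ([degeneracy_Gk]).

    At least k cops are needed.  The distances from a probe to the 3 ^ k core
    vertices of a closed neighbourhood take at most three consecutive values,
    so fewer than k probes leave two of those vertices with equal distance
    vectors.  The robber moves to one of them, inside the core, for ever
    ([distvec_twins], [robber_evades]).

    k cops are enough.  The game is followed through the set of positions
    that the cops still consider possible ([wins]).  The satellite s_{i,t} is
    at distance 40 plus a cyclic distance from a core vertex, so probing one
    satellite for each coordinate i (with t = 0 or 10, chosen coordinate by
    coordinate) reads one cyclic distance in every coordinate; the distances
    to 0 and to 10 together determine the coordinate.

    The legs (the subdivided edges) give the robber only two ways of
    disturbing this.  If he is on a leg of a probed satellite, a distance
    below 40 betrays him, and from then on one cop stays on that satellite and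
    reads his level on the leg.  Far from the satellite the other cops read
    the remaining coordinates of the leg from both marks; near it they try the
    legs one by one, and he cannot climb away from there without crossing the
    levels where the coordinates can be read ([wins_seen],
    [wins_satellites]).  If he has just stepped onto a leg of an unprobed
    satellite, all distances look as if he had moved in the core by one step
    away from every probed mark.

    The cops therefore play as follows.  Two rounds leave, in each
    coordinate, either one value or the two neighbours of 0, 10 or 30; the
    second round is chosen so that an unseen robber is in the core.  The third
    round then leaves at most one core vertex y, together with the neighbours
    of one core vertex w on the legs that end in w ([wins_third]).  In the next
    round the legs over w are probed, and in the remaining coordinates the
    marks are chosen so that the next core vertex consistent with a leg over y
    has no coordinate 0 or 10 and thus carries no leg itself.  One more round
    ends the game ([wins_shadow]). *)

(** * Distances *)

Section Distance.

Variable G : sgraph.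
Hypothesis G_conn : connected G.

Lemma dist_le_path (x : G) p : path (@adj G) x p -> dist x (last x p) <= size p.
Proof.
move=> xp; rewrite /dist; set a := (X in find X _).
have [ltp|lep] := ltnP (size p) #|G|; last first.
  by apply: leq_trans lep; rewrite -[leqRHS](size_iota 0) find_size.
rewrite leqNgt; apply/negP=> /(before_find 0).
rewrite nth_iota // add0n /a => /existsP; case.
by exists (in_tuple p); rewrite xp eqxx.
Qed.

Lemma geodesic (x y : G) :
  exists p, [/\ path (@adj G) x p, last x p = y & size p = dist x y].
Proof.
have /connectP[p0 xp0 ->] := G_conn x y.
case/shortenP: xp0 => p xp Up _; rewrite /dist; set a := (X in find X _).
have ha : has a (iota 0 #|G|).
  apply/hasP; exists (size p).
    by rewrite mem_iota add0n; have := max_card (mem (x :: p));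
      rewrite (card_uniqP Up).
  by apply/existsP; exists (in_tuple p); rewrite xp eqxx.
have := nth_find 0 ha; rewrite nth_iota; last first.
  by rewrite -[ltnRHS](size_iota 0) -has_find.
by rewrite add0n => /existsP[q /andP[xq /eqP qy]]; exists q; rewrite size_tuple.
Qed.

Lemma dist_adj (x y z : G) : adj y z -> dist x z <= (dist x y).+1.
Proof.
move=> yz; have [p [xp py <-]] := geodesic x y.
have -> : z = last x (rcons p z) by rewrite last_rcons.
by rewrite -(size_rcons p z) dist_le_path // rcons_path xp py.
Qed.

Lemma dist_step (x y z : G) : robber_step y z -> dist x z <= (dist x y).+1.
Proof. by case/orP=> [/eqP->|/dist_adj->]. Qed.

Lemma robber_step_sym : symmetric (@robber_step G).
Proof. by move=> x y; rewrite /robber_step eq_sym adj_sym. Qed.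

(** The way lower bounds on distances are obtained below: a function that
    changes by at most 1 along edges cannot change more than the distance. *)
Lemma lipschitz_le_dist (f : G -> nat) (x y : G) :
  (forall a b : G, adj a b -> f b <= (f a).+1) -> f y <= f x + dist x y.
Proof.
move=> f_lip; have [p [xp <- <-]] := geodesic x y.
elim: p x xp => [|z p IHp] x /=; first by rewrite addn0.
by case/andP=> /f_lip fz /IHp; lia.
Qed.

Lemma distxx (x : G) : dist x x = 0.
Proof. by have := @dist_le_path x [::] isT; case: dist. Qed.

End Distance.

(** * The game as a game on knowledge sets *)

Section Knowledge.

Variables (G : sgraph) (m : nat).
Implicit Types (S : {set G}) (u : m.-tuple G).

Definition nbh S : {set G} := [set y | [exists x in S, robber_step x y]].

(** The positions that remain possible when the robber was known to be in [S]
    and the probe [u] has the result that it has at [x]. *)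
Definition cell u S (x : G) : {set G} :=
  [set y in S | distvec u y == distvec u x].

(** [S] is the set of possible positions just before a probe.  The fuel makes
    the predicate decidable, so that the cops can search for a good probe, and
    it counts the remaining rounds. *)
Fixpoint forced n S : bool :=
  if n is n'.+1 then
    [exists u, [forall x in S,
      (#|cell u S x| <= 1) || forced n' (nbh (cell u S x))]]
  else false.

Definition wins S : Prop := exists n, forced n S.

Lemma nbhP S y : reflect (exists2 x, x \in S & robber_step x y) (y \in nbh S).
Proof. by rewrite inE; apply: exists_inP. Qed.

Lemma nbhS S S' : S \subset S' -> nbh S \subset nbh S'.
Proof.
move=> sSS'; apply/subsetP=> y /nbhP[x xS xy].
by apply/nbhP; exists x => //; apply: (subsetP sSS').
Qed.

Lemma cellS u S S' x : S \subset S' -> cell u S x \subset cell u S' x.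
Proof.
by move=> /subsetP sSS'; apply/subsetP=> y; rewrite !inE => /andP[/sSS' ->].
Qed.

Lemma forced_sub n S S' : S \subset S' -> forced n S' -> forced n S.
Proof.
elim: n S S' => //= n IHn S S' sSS' /existsP[u /forall_inP uS'].
apply/existsP; exists u; apply/forall_inP=> x xS.
have/orP[c1|cn] := uS' x (subsetP sSS' x xS).
  by rewrite (leq_trans (subset_leq_card (cellS u x sSS'))).
by rewrite (IHn _ _ (nbhS (cellS u x sSS')) cn) orbT.
Qed.

Lemma forcedS n n' S : n <= n' -> forced n S -> forced n' S.
Proof.
elim: n n' S => //= n IHn [//|n'] S; rewrite ltnS => /IHn le_n /=.
move=> /existsP[u /forall_inP uS]; apply/existsP; exists u.
by apply/forall_inP=> x /uS /orP[->//|/le_n]; rewrite orbC => ->.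
Qed.

Lemma wins_sub S S' : S \subset S' -> wins S' -> wins S.
Proof. by move=> sSS' [n wn]; exists n; apply: forced_sub wn. Qed.

(** A probe has finitely many results, so the rounds needed after each of them
    have a common bound. *)
Lemma wins_probe u S :
  (forall x, x \in S -> #|cell u S x| <= 1 \/ wins (nbh (cell u S x))) ->
  wins S.
Proof.
move=> uS; have /fin_all_exists[f fP] (x : G) : exists n, x \in S ->
    (#|cell u S x| <= 1) || forced n (nbh (cell u S x)).
  have [xS|_] := boolP (x \in S); last by exists 0.
  case: (uS x xS) => [c1|[n cn]]; first by exists 0; rewrite c1.
  by exists n; rewrite cn orbT.
exists (\max_x f x).+1; apply/existsP; exists u; apply/forall_inP=> x xS.
have /orP[->//|fx] := fP x xS.
by apply/orP; right; apply: forcedS (leq_bigmax x) fx.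
Qed.

Definition knowledge (h : history G m) : {set G} :=
  foldl (fun S ud => nbh [set y in S | distvec ud.1 y == ud.2]) setT h.

Lemma knowledge_consistent (sigma : strategy G m) r r' t :
  consistent sigma r r' t ->
  forall s, s <= t -> r' s \in knowledge (play sigma r s).
Proof.
case=> r'_step r'_dist; elim=> [_|s IHs lt_st]; first exact: in_setT.
rewrite /knowledge /= foldl_rcons; apply/nbhP; exists (r' s);
  last exact: r'_step.
by rewrite inE IHs ?(ltnW lt_st) //=; apply/eqP/r'_dist/ltnW.
Qed.

Lemma size_play (sigma : strategy G m) r t : size (play sigma r t) = t.
Proof. by elim: t => //= t IHt; rewrite size_rcons IHt. Qed.

(** The cops recompute their knowledge from the history, and the length of the
    history tells how much fuel is left; they play a probe that is good for
    this fuel.  As fuel 0 is never enough, a capture happens before. *)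
Lemma cops_win_of_wins : wins setT -> cops_win G m.
Proof.
case=> -[//|n] /[dup] win_n /existsP[u0 _].
pose good j S u := [forall x in S,
  (#|cell u S x| <= 1) || forced j (nbh (cell u S x))].
pose sigma h := odflt u0 [pick u | good (n - size h) (knowledge h) u].
exists sigma => r r_traj.
have r_cons t : consistent sigma r r t by split.
have main t : t <= n.+1 -> (exists s, captured sigma r s) \/
    forced (n.+1 - t) (knowledge (play sigma r t)).
  elim: t => [_|t IHt lt_tn]; first by right.
  case: (IHt (ltnW lt_tn)) => [|win_t]; first by left.
  have: good (n - t) (knowledge (play sigma r t)) (probe sigma r t).
    move: win_t; rewrite subSn // => /existsP[u u_good].
    rewrite /probe /sigma size_play; case: pickP => //= /(_ u).
    by rewrite /good u_good.
  move=> /forall_inP/(_ (r t)).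
  rewrite (knowledge_consistent (r_cons t)) // => /(_ isT).
  case/orP=> [c1|win_c]; last first.
    right; rewrite subSS /knowledge /= foldl_rcons; exact: win_c.
  left; exists t => r' r'_cons; apply: (card_le1_eqP c1).
    by rewrite inE eqxx andbT; exact: (knowledge_consistent (r_cons t)).
  rewrite inE; apply/andP; split; last exact/eqP/r'_cons.2.
  exact: (knowledge_consistent r'_cons).
by case: (main n.+1 (leqnn _)) => //; rewrite subnn.
Qed.

End Knowledge.

(** * Escaping too few cops *)

Section Evasion.

Variables (G : sgraph) (m : nat).
Hypothesis G_conn : connected G.

(** The distances from a probe to the vertices near [v] differ from its
    distance to [v] by at most 1, so [m] probes see at most [3 ^ m] patterns. *)
Lemma distvec_twins (u : m.-tuple G) (v : G) (S : {set G}) :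
  {in S, forall y, robber_step v y} -> 3 ^ m < #|S| ->
  exists y y', [/\ y \in S, y' \in S, distvec u y = distvec u y' & y != y'].
Proof.
move=> S_v lt_S.
(* The value 1 stands for the distance to [v] itself; the successor avoids a
   truncated difference. *)
pose code y : {ffun 'I_m -> 'I_3} :=
  [ffun j => inord ((dist (tnth u j) y).+1 - dist (tnth u j) v)].
have /dinjectivePn[y yS [y' /andP[ne y'S] eq_code]] :
    ~~ dinjectiveb code (mem S).
  apply/negP=> /dinjectiveP inj_code; have := max_card (mem (code @: S)).
  by rewrite card_in_imset // card_ffun !card_ord leqNgt lt_S.
exists y, y'; split; rewrite // 1?eq_sym //.
apply: eq_from_tnth => j; rewrite !tnth_mktuple.
move/ffunP/(_ j)/(congr1 val): eq_code; rewrite !ffunE.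
have close_dist z : z \in S -> dist (tnth u j) z <= (dist (tnth u j) v).+1 /\
    dist (tnth u j) v <= (dist (tnth u j) z).+1.
  by move=> /S_v vz; split; apply: dist_step; rewrite // robber_step_sym.
have [d1 d2] := close_dist y yS; have [d3 d4] := close_dist y' y'S.
rewrite /= !inordK //; lia.
Qed.

(** The robber knows the cops' strategy: before each probe he moves, within
    [C], to a vertex that the probe does not distinguish from another vertex
    within his reach. *)
Lemma robber_evades (C : {set G}) (v0 : G) : v0 \in C ->
  {in C, forall v, 3 ^ m < #|[set y in C | robber_step v y]|} ->
  ~ cops_win G m.
Proof.
move=> v0C C_deg [sigma sigma_wins].
pose twins (u : m.-tuple G) v (p : G * G) :=
  [&& p.1 \in C, p.2 \in C, robber_step v p.1, robber_step v p.2,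
      distvec u p.1 == distvec u p.2 & p.1 != p.2].
pose next u v := odflt (v, v) [pick p | twins u v p].
have nextP u v : v \in C -> twins u v (next u v).
  move=> vC; rewrite /next; case: pickP => //= no_twins.
  have v_sub : {in [set y in C | robber_step v y], forall y, robber_step v y}.
    by move=> y; rewrite inE => /andP[].
  have [y [y' []]] := distvec_twins u v_sub (C_deg v vC).
  rewrite !inE => /andP[yC vy] /andP[y'C vy'] /eqP eq_d ne.
  by have := no_twins (y, y'); rewrite /twins /= yC y'C vy vy' eq_d ne.
(* The history before round [t], and the position from which the robber
   chooses his position of round [t]. *)
pose fix state t : history G m * G := if t is t'.+1 then
    let: (h, v) := state t' in let y := (next (sigma h) v).1 in
    (rcons h (sigma h, distvec (sigma h) y), y)
  else ([::], v0).
pose pair t := next (sigma (state t).1) (state t).2.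
pose r t := (pair t).1.
have stateS t : state t.+1 = (rcons (state t).1 (sigma (state t).1,
    distvec (sigma (state t).1) (r t)), r t).
  by rewrite /r /pair /=; case: (state t).
have stateC t : (state t).2 \in C.
  by elim: t => // t /nextP; rewrite stateS => /(_ (sigma (state t).1))/and3P[].
have pairP t : twins (sigma (state t).1) (state t).2 (pair t) by apply: nextP.
have playE t : play sigma r t = (state t).1.
  by elim: t => // t IHt; rewrite stateS /= IHt.
have r_traj : trajectory r.
  by move=> t; have /and4P[_ _] := pairP t.+1; rewrite stateS.
have [t capt] := sigma_wins r r_traj.
have /and5P[_ _ _ step2 /andP[/eqP eq_d /eqP ne]] := pairP t.
(* The trajectory that agrees with [r] before round [t] and then takes the
   twin of the last position. *)
pose r' s := if s < t then r s else (pair t).2.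
case: ne; have <- : r' t = (pair t).2 by rewrite /r' ltnn.
apply/esym/capt; split=> [s lt_st|s le_st].
  rewrite /r' lt_st; case: (ltnP s.+1 t) => [_|le_ts]; first exact: r_traj.
  have /eqP eq_t : t == s.+1 by rewrite eqn_leq le_ts.
  by move: step2; rewrite eq_t stateS.
rewrite /r'; case: (ltnP s t) => // le_ts.
have /eqP-> : s == t by rewrite eqn_leq le_st.
by rewrite /probe playE -eq_d.
Qed.

End Evasion.

(** * Degeneracy through vertex sets *)

Section Degeneracy.

Variable G : sgraph.

(** An edge at [x] is determined by its other end. *)
Lemma subdegree_le (H : {set G} * {set {set G}}) (x : G) : is_subgraph H ->
  subdegree H x <= #|[set y in H.1 | adj x y]|.
Proof.
move=> /andP[/subsetP H_edges /forall_inP H_ends].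
apply: leq_trans (leq_imset_card (fun y => [set x; y]) _).
apply/subset_leq_card/subsetP=> f; rewrite inE => /andP[fH xf].
have /imsetP[[a b]] := H_edges f fH; rewrite inE /= => ab def_f.
have /subsetP f_ends := H_ends f fH.
move: xf; rewrite def_f !inE => /orP[]/eqP def_x; apply/imsetP; subst x.
  by exists b; rewrite // inE ab f_ends // def_f !inE eqxx orbT.
exists a; last by rewrite setUC.
by rewrite inE adj_sym ab f_ends // def_f !inE eqxx.
Qed.

Definition induced (C : {set G}) : {set G} * {set {set G}} :=
  (C, [set f in edges G | f \subset C]).

Lemma induced_subgraph C : is_subgraph (induced C).
Proof.
apply/andP; split; first by apply/subsetP=> f; rewrite inE => /andP[].
by apply/forall_inP=> f; rewrite inE => /andP[].
Qed.

Lemma subdegree_induced (C : {set G}) (x : G) : x \in C ->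
  #|[set y in C | adj x y]| <= subdegree (induced C) x.
Proof.
move=> xC; rewrite -(@card_in_imset _ _ (fun y => [set x; y])); last first.
  move=> y z; rewrite !inE => /andP[_ xy] _ /setP/(_ y).
  rewrite !inE eqxx orbT; case: eqP => [y_x|_] /esym/eqP //.
  by rewrite y_x adj_irr in xy.
apply/subset_leq_card/subsetP=> f /imsetP[y]; rewrite inE => /andP[yC xy] ->.
rewrite !inE eqxx andbT; apply/andP; split.
  by apply/imsetP; exists (x, y); rewrite ?inE.
by apply/subsetP=> z; rewrite !inE => /orP[]/eqP->.
Qed.

Lemma min_degree_le (H : {set G} * {set {set G}}) (x : G) : x \in H.1 ->
  min_degree H <= subdegree H x.
Proof.
move=> xH; rewrite /min_degree; move: (mem_index_enum x).
elim: (index_enum _) => // y s IHs; rewrite inE big_cons.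
case/predU1P=> [<-|/IHs le_x]; first by rewrite xH geq_minl.
by case: ifP => _ //; apply: leq_trans (geq_minr _ _) le_x.
Qed.

Lemma degeneracy_le d :
  (forall V : {set G}, V != set0 ->
    exists2 x, x \in V & #|[set y in V | adj x y]| <= d) ->
  degeneracy G <= d.
Proof.
move=> V_small; apply/bigmax_leqP=> H /andP[subH /V_small[x xH le_d]].
exact: leq_trans (min_degree_le xH) (leq_trans (subdegree_le x subH) le_d).
Qed.

Lemma degeneracy_ge d (C : {set G}) : C != set0 ->
  {in C, forall x, d <= #|[set y in C | adj x y]|} -> d <= degeneracy G.
Proof.
move=> Cn0 C_deg; apply: (@leq_trans (min_degree (induced C))); last first.
  apply: (@leq_bigmax_cond _ _ (@min_degree G) (induced C)).
  by rewrite induced_subgraph.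
rewrite /min_degree; apply: (big_ind (fun n => d <= n)) => [|a b|x xC].
- have /set0Pn[x /C_deg le_d] := Cn0.
  by apply: leq_trans le_d _; apply: max_card.
- by rewrite leq_min => -> ->.
exact: leq_trans (C_deg x xC) (subdegree_induced xC).
Qed.

End Degeneracy.

(** * One coordinate of the core *)

Section CyclicCoordinate.

Implicit Types (t : bool) (a b c : 'I_40).

(** [cyc_close] on natural numbers: statements about one coordinate become
    finite checks over [iota 0 40] that can be evaluated. *)
Definition near (a b : nat) : bool :=
  [|| a == b, b == a.+1 %% 40 | a == b.+1 %% 40].

Definition mark t : nat := if t then 10 else 0.

Definition marked (a : nat) : bool := (a == mark false) || (a == mark true).

Definition cdist t (a : nat) : nat :=
  let e := (a - mark t) + (mark t - a) in minn e (40 - e).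

Lemma cyc_closeE a b : cyc_close a b = near a b.
Proof. by []. Qed.

Lemma near_sym : symmetric near.
Proof. by move=> a b; rewrite /near eq_sym; congr orb; rewrite orbC. Qed.

Lemma near_refl : reflexive near.
Proof. by move=> a; rewrite /near eqxx. Qed.

Lemma card_cyc_close a : #|cyc_close a| = 3.
Proof.
have -> : #|cyc_close a| = #|[set a; ordS a; ord_pred a]|.
  apply: eq_card => b; rewrite !inE /in_mem /= /cyc_close -orbA (eq_sym a b).
  by rewrite (eq_sym a (ordS b)) (can2_eq (@ordSK _) (@ord_predK _)).
have ltn_a := ltn_ord a.
rewrite setUC !cardsU1 cards1 !inE -!val_eqE /=; lia.
Qed.

Lemma forall_ord40 (P : pred nat) :
  all P (iota 0 40) -> forall a, P a.
Proof. by move=> /allP allP a; apply: allP; rewrite mem_iota /=. Qed.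

Lemma forall2_ord40 (P : rel nat) :
  all (fun n => all (P n) (iota 0 40)) (iota 0 40) -> forall a b, P a b.
Proof. by move=> allP a b; apply: forall_ord40; apply: (forall_ord40 allP a). Qed.

Lemma cdist_le t a : cdist t a <= 20.
Proof. by have := ltn_ord a; rewrite /cdist /mark; case: t; lia. Qed.

Lemma cdist_near t a b : near a b -> cdist t b <= (cdist t a).+1.
Proof.
apply/implyP; move: a b.
apply: (@forall2_ord40 (fun m n => near m n ==> (cdist t n <= (cdist t m).+1))).
by case: t; vm_compute.
Qed.

Lemma cdist_eq0 t a : (cdist t a == 0) = (a == mark t :> nat).
Proof. by have := ltn_ord a; rewrite /cdist /mark; case: t; lia. Qed.

Lemma cdist_pred t a n : cdist t a = n.+1 ->
  exists2 b, cyc_close a b & cdist t b = n.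
Proof.
move=> an; have : (cdist t (ordS a) == n) || (cdist t (ord_pred a) == n).
  have -> : n = (cdist t a).-1 by rewrite an.
  have : 0 < cdist t a by rewrite an.
  apply/implyP; move: a {n an}; apply: (@forall_ord40 (fun m =>
    (0 < cdist t m) ==> ((cdist t (m.+1 %% 40) == (cdist t m).-1) ||
      (cdist t ((m + 40).-1 %% 40) == (cdist t m).-1)))).
  by case: t; vm_compute.
case/orP=> /eqP bn.
  by exists (ordS a); rewrite // /cyc_close eqxx orbT.
by exists (ord_pred a); rewrite // /cyc_close ord_predK eqxx !orbT.
Qed.

(** Equal distances to 0 mean [b = a] or [b = - a], and equal distances to 10
    mean [b = a] or [b = 20 - a], modulo 40. *)
Lemma cdist_inj t a b :
  cdist t a = cdist t b -> cdist (~~ t) a = cdist (~~ t) b -> a = b.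
Proof.
move=> /eqP eq1 /eqP eq2; apply/val_inj/eqP.
apply: (implyP (implyP _ eq1) eq2); move: a b {eq1 eq2}.
apply: (@forall2_ord40 (fun m n => (cdist t m == cdist t n) ==>
  (cdist (~~ t) m == cdist (~~ t) n) ==> (m == n))).
by case: t; vm_compute.
Qed.

End CyclicCoordinate.

(** * Vertices and neighbours in G_k *)

Section Geometry.

Variable k : nat.
Implicit Types (w v : core k) (s : satellite k) (l : leg k) (x y : Gk k).

Definition corev w : Gk k := inl (inl w).
Definition sat s : Gk k := inl (inr s).

(** The vertices of a leg by their distance [e] from the satellite: level 0 is
    the satellite, levels 1 to 39 are interior, and level 40 is the core end. *)
Definition on_leg l (e : nat) : Gk k :=
  if e is e'.+1 then
    if (insub e' : option 'I_39) is Some j then inr (l, j) else corev (val l).2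
  else sat (val l).1.

Arguments on_leg : simpl never.

Lemma on_leg_internal l (j : 'I_39) : on_leg l j.+1 = inr (l, j).
Proof. by rewrite /on_leg valK. Qed.

Lemma on_leg_lt l e (lt_e : e < 39) : on_leg l e.+1 = inr (l, Ordinal lt_e).
Proof. by rewrite /on_leg insubT. Qed.

Lemma on_leg_core l : on_leg l 40 = corev (val l).2.
Proof. by rewrite /on_leg insubF. Qed.

Lemma leg_mark l : (val l).2 (val l).1.1 = mark (val l).1.2 :> nat.
Proof. by have /eqP-> := valP l; rewrite /level /mark. Qed.

Lemma adj_on_leg l e : e < 40 -> adj (on_leg l e) (on_leg l e.+1).
Proof.
case: e => [_|e lt_e]; first by rewrite (@on_leg_lt l 0) //= /gk_adj /= !eqxx.
rewrite (@on_leg_lt l e) //; have [lt_e1|] := ltnP e.+1 39.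
  by rewrite (on_leg_lt l lt_e1) /= /gk_adj /= !eqxx.
rewrite ltnS => le_e; have def_e : e = 38 by lia.
by subst e; rewrite on_leg_core /= /gk_adj /= eqxx.
Qed.

Lemma adj_internal l (j : 'I_39) y :
  adj (inr (l, j) : Gk k) y -> y = on_leg l j \/ y = on_leg l j.+2.
Proof.
rewrite /= /gk_adj; case: y => [[v|s]|[l' j']] /=.
- by rewrite orbF => /andP[/eqP-> /eqP->]; right; rewrite on_leg_core.
- by move=> /andP[/eqP-> /eqP->]; left.
case/orP=> /andP[/eqP-> /eqP e]; [right|left]; rewrite -?e ?on_leg_internal //.
by rewrite e on_leg_internal.
Qed.

Lemma adj_sat s y : adj (sat s) y -> exists l j, y = inr (l, j).
Proof. by case: y => [[v|s']|[l j]] //= _; exists l, j. Qed.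

Lemma step_internal l e y : 0 < e < 40 -> robber_step (on_leg l e) y ->
  exists2 e', y = on_leg l e' & e' <= e.+1 /\ e <= e'.+1.
Proof.
case: e => // e; rewrite !ltnS => lt_e; rewrite (@on_leg_lt l e) //.
case/predU1P=> [->|/adj_internal[]->].
- by exists e.+1; rewrite ?on_leg_lt //; lia.
- by exists e => //=; lia.
by exists e.+2 => //=; lia.
Qed.

Lemma step_core w v :
  robber_step (corev w) (corev v) = [forall i, cyc_close (w i) (v i)].
Proof.
have closeC : core_adj v w = core_adj w v.
  rewrite /core_adj eq_sym; congr andb; apply: eq_forallb => i.
  by rewrite !cyc_closeE near_sym.
rewrite /robber_step /= /gk_adj /= closeC orbb /core_adj.
have -> : (corev v == corev w) = (w == v) by rewrite eq_sym.
have [<-|] //= := eqVneq w v.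
by apply/esym/forallP=> i; rewrite cyc_closeE near_refl.
Qed.

Lemma step_out_of_core w y : robber_step (corev w) y ->
  (exists2 v, y = corev v & forall i, near (w i) (v i)) \/
  (exists2 l, y = on_leg l 39 & (val l).2 = w).
Proof.
case: y => [[v|s]|[l j]]; last 1 first.
- rewrite /robber_step /= /gk_adj /= => /andP[/eqP-> /eqP e].
  by right; exists l; rewrite // -on_leg_internal e.
- by rewrite (step_core w v) => /forallP wv; left; exists v.
by [].
Qed.

Definition core_set : {set Gk k} := [set corev w | w : core k].

Lemma corev_inj : injective corev. Proof. by move=> w v []. Qed.

(** The closed neighbourhood is a product of arcs of three points. *)
Lemma card_core_ball w :
  #|[set y in core_set | robber_step (corev w) y]| = 3 ^ k.
Proof.
have -> : [set y in core_set | robber_step (corev w) y] =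
    corev @: [set v in family (fun i => cyc_close (w i))].
  apply/setP=> y; rewrite inE; apply/andP/imsetP.
    case=> /imsetP[v _ ->]; rewrite step_core => /forallP wv.
    by exists v; rewrite // inE; apply/familyP.
  case=> v; rewrite inE => /familyP wv ->; split; first exact: imset_f.
  by rewrite step_core; apply/forallP.
rewrite (card_imset _ corev_inj) cardsE card_family.
rewrite -[RHS](congr1 (expn 3) (size_enum_ord k)) /image_mem.
have -> : enum (mem predT) = enum 'I_k by [].
by elim: (enum _) => //= i e ->; rewrite card_cyc_close expnS.
Qed.

Lemma core_degree w : #|[set y in core_set | adj (corev w) y]| = 3 ^ k - 1.
Proof.
set B := [set y in core_set | robber_step (corev w) y].
have wB : corev w \in B by rewrite inE imset_f // /robber_step eqxx.
rewrite -(card_core_ball w) -/B (cardsD1 (corev w) B) wB addKn.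
apply: eq_card => y; rewrite !inE.
rewrite /robber_step; have [->|] := eqVneq y (corev w); last by [].
by rewrite adj_irr andbF.
Qed.

(** In a vertex set without interior vertices the satellites are isolated, and
    a set without satellites either lies in the core. *)
Lemma degeneracy_Gk : 0 < k -> degeneracy (Gk k) = 3 ^ k - 1.
Proof.
move=> k_gt0; apply/eqP; rewrite eqn_leq; apply/andP; split; last first.
  apply: (@degeneracy_ge _ _ core_set).
    by apply/set0Pn; exists (corev [ffun=> ord0]); apply: imset_f.
  by move=> _ /imsetP[w _ ->]; rewrite core_degree.
apply: degeneracy_le => V /set0Pn[x0 x0V].
case: (pickP (fun p : internal k => (inr p : Gk k) \in V)) => [[l j] xV|no_int].
  exists (inr (l, j)) => //; apply: leq_trans (_ : 2 <= _); last first.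
    by rewrite -(prednK k_gt0) expnS; have := expn_gt0 3 k.-1; lia.
  apply: leq_trans (_ : #|[set on_leg l j; on_leg l j.+2]| <= _); last first.
    by rewrite cards2; case: eqP.
  apply/subset_leq_card/subsetP=> y; rewrite !inE => /andP[_ /adj_internal].
  by case=> ->; rewrite eqxx ?orbT.
case: (pickP (fun s => sat s \in V)) => [s xV|no_sat].
  exists (sat s) => //; apply: leq_trans (_ : 0 <= _) => //.
  rewrite leqn0 cards_eq0; apply/eqP/setP=> y; rewrite !inE.
  apply/negP=> /andP[yV /adj_sat[l [j def_y]]].
  by have := no_int (l, j); rewrite -def_y yV.
have V_core : V \subset core_set.
  apply/subsetP=> [[[w|s]|p]] => [_|sV|pV]; first exact: imset_f.
  - by have := no_sat s; rewrite sV.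
  by have := no_int p; rewrite pV.
have /imsetP[w _ def_x0] := subsetP V_core x0 x0V.
exists x0; rewrite // def_x0 -(core_degree w); apply/subset_leq_card/subsetP=> y.
by rewrite !inE => /andP[/(subsetP V_core) -> ->].
Qed.

Lemma Gk_lower_bound m : m < k -> ~ cops_win (Gk k) m.
Proof.
move=> lt_mk; apply: (robber_evades (@Gk_connected k) (C := core_set)).
  exact: (imset_f corev (x := [ffun=> ord0])).
by move=> _ /imsetP[w _ ->]; rewrite card_core_ball ltn_exp2l.
Qed.

End Geometry.
Arguments on_leg : simpl never.

(** * Distances in G_k *)

Section Metric.

Variable k : nat.
Implicit Types (w v : core k) (s : satellite k) (l : leg k) (x y : Gk k).

Let conn := @Gk_connected k.

Lemma arc_lipschitz (f : Gk k -> nat) :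
  (forall x y, gk_arc x y -> f y <= (f x).+1 /\ f x <= (f y).+1) ->
  forall x y, f y <= f x + dist x y.
Proof.
move=> f_arc x y; apply: (lipschitz_le_dist conn) => a b.
by rewrite /= /gk_adj => /orP[]/f_arc[].
Qed.

(** A potential that bounds the distance to the satellite [s] from below.  On a
    leg of another satellite the competing routes go through the core end of
    the leg or down to its satellite; the latter is only approximated, as two
    satellites of one coordinate are at distance 90 and not 80. *)
Definition satdist s x : nat :=
  match x with
  | inl (inl w) => 40 + cdist s.2 (w s.1)
  | inl (inr s') => if s' == s then 0 else 80
  | inr (l, j) => if (val l).1 == s then j.+1
                  else minn (79 - j + cdist s.2 ((val l).2 s.1)) (81 + j)
  end.

Lemma satdist_le s x : satdist s x <= dist (sat s) x.
Proof.
have -> : dist (sat s) x = satdist s (sat s) + dist (sat s) x.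
  by rewrite /= eqxx.
apply: arc_lipschitz => {x} [[[w|s1]|[l j]] [[w'|s2]|[l' j']]] //=.
- case/andP=> _ /forallP/(_ s.1); rewrite cyc_closeE => ww'.
  have := cdist_near s.2 ww'; rewrite near_sym in ww'.
  by have := cdist_near s.2 ww'; lia.
- by move=> /andP[/eqP-> /eqP->]; case: eqP => // _; lia.
- have := cdist_le s.2 (w' s.1) => w'_le /andP[/eqP def_w' /eqP->].
  rewrite -def_w'; case: eqP => [def_s|_]; last first.
  move: w'_le; set c := cdist _ _; lia.
  suff /eqP-> : cdist s.2 (w' s.1) == 0 by [].
  by rewrite cdist_eq0 def_w' -def_s; apply/eqP/leg_mark.
by move=> /andP[/eqP<- /eqP->]; case: eqP => // _; lia.
Qed.

(** Every vertex of a leg can be reached by coming down from its core end. *)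
Lemma dist_descend x l n e :
  e <= 40 -> n <= e -> dist x (on_leg l (e - n)) <= dist x (on_leg l e) + n.
Proof.
move=> le_e; elim: n => [|n IHn] le_n; first by rewrite subn0 addn0.
have := IHn (ltnW le_n); have -> : e - n = (e - n.+1).+1 by lia.
have lt_e : e - n.+1 < 40 by lia.
have := @dist_adj _ conn x (on_leg l (e - n.+1).+1) (on_leg l (e - n.+1)).
rewrite adj_sym adj_on_leg // => /(_ isT); lia.
Qed.

Lemma dist_own l e : e <= 40 -> dist (sat (val l).1) (on_leg l e) = e.
Proof.
move=> le_e; apply/eqP; rewrite eqn_leq; apply/andP; split.
  elim: e le_e => [|e IHe] le_e; first by rewrite (distxx (on_leg l 0)).
  apply: leq_trans (dist_adj conn _ (adj_on_leg l le_e)) _.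
  by rewrite ltnS IHe // ltnW.
apply: leq_trans (satdist_le _ _); case: e le_e => // e.
rewrite leq_eqVlt => /orP[/eqP->|lt_e]; first by rewrite on_leg_core /= leq_addr.
by rewrite (@on_leg_lt _ l e) //= eqxx.
Qed.

(** Start on the leg of [s] that ends in [w] with the coordinate of [s] reset to
    the mark, then move this coordinate only. *)
Lemma dist_core s w : dist (sat s) (corev w) = 40 + cdist s.2 (w s.1).
Proof.
apply/eqP; rewrite eqn_leq (satdist_le s (corev w)) andbT.
move def_n : (cdist _ _) => n; elim: n w def_n => [|n IHn] w wn.
  have w_s : w s.1 == level s :> nat by rewrite -cdist_eq0 wn.
  have := dist_own (exist _ (s, w) w_s) (leqnn 40).
  by rewrite on_leg_core /= => ->.
have [b wb bn] := cdist_pred wn.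
pose v : core k := [ffun i => if i == s.1 then b else w i].
have v_w : robber_step (corev v) (corev w).
  rewrite step_core; apply/forallP=> i; rewrite ffunE cyc_closeE.
  by case: eqP => [->|_]; rewrite ?near_refl // near_sym -cyc_closeE.
apply: leq_trans (dist_step conn _ v_w) _; rewrite addnS ltnS IHn //.
by rewrite ffunE eqxx.
Qed.

(** A cyclic distance is at most 20, so from level 10 upwards the route through
    the core end is the shorter one. *)
Lemma dist_other s l e : s != (val l).1 -> 10 <= e <= 40 ->
  dist (sat s) (on_leg l e) = 80 - e + cdist s.2 ((val l).2 s.1).
Proof.
move=> ne_s /andP[ge_e le_e]; apply/eqP; rewrite eqn_leq; apply/andP; split.
  have le_sub : 40 - e <= 40 by lia.
  have := dist_descend (sat s) l (leqnn 40) le_sub.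
  by rewrite on_leg_core dist_core subKn //; lia.
apply: leq_trans (satdist_le _ _); case: e ge_e le_e => // e ge_e.
rewrite leq_eqVlt => /orP[/eqP[->]|lt_e]; first by rewrite on_leg_core.
rewrite (@on_leg_lt _ l e) //= eq_sym (negbTE ne_s).
by move: (cdist_le s.2 ((val l).2 s.1)); set c := cdist _ _; lia.
Qed.

(** The region of a satellite consists of its legs without their core ends; by
    [region_dist] it is the open ball of radius 40. *)
Definition in_region s x : bool :=
  match x with
  | inl (inl _) => false
  | inl (inr s') => s' == s
  | inr (l, _) => (val l).1 == s
  end.

Lemma core_leg w i t : w i = mark t :> nat -> exists l, val l = ((i, t), w).
Proof. by move/eqP=> wt; exists (exist _ ((i, t), w) wt). Qed.

Lemma in_regionP s x :
  reflect (exists l e, [/\ (val l).1 = s, e < 40 & x = on_leg l e])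
          (in_region s x).
Proof.
apply: (iffP idP) => [|[l [e [<- lt_e ->]]]]; last first.
  case: e lt_e => [|e] lt_e; first by rewrite /= eqxx.
  by rewrite (@on_leg_lt _ l e) //= eqxx.
case: x => [[w|s']|[l j]] //= /eqP <-; last first.
  by exists l, j.+1; rewrite on_leg_internal; split=> //; rewrite ltnS ltn_ord.
have lt_m : mark s'.2 < 40 by rewrite /mark; case: s'.2.
have [|l l_s] := @core_leg [ffun=> Ordinal lt_m] s'.1 s'.2.
  by rewrite ffunE.
by exists l, 0; rewrite l_s -surjective_pairing /on_leg l_s -surjective_pairing.
Qed.

Lemma region_dist s x : in_region s x = (dist (sat s) x < 40).
Proof.
apply/idP/idP => [/in_regionP[l [e [<- lt_e ->]]]|].
  by rewrite dist_own // ltnW.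
apply: contraTT => out_x; rewrite -leqNgt; apply: leq_trans (satdist_le _ _).
case: x out_x => [[w|s']|[l j]] /=; first by rewrite leq_addr.
  by move/negbTE->.
by move/negbTE->; have := ltn_ord j; lia.
Qed.

(** A robber in the region of s_{i,10} cannot be mistaken for one whose [i]th
    coordinate is 0, even up to one step. *)
Lemma region_far i x : in_region (i, true) x -> 51 <= dist (sat (i, false)) x.
Proof.
move=> in_x; apply: leq_trans (satdist_le _ _).
case: x in_x => [[w|s']|[l j]] //= /eqP.
  by move->; rewrite xpair_eqE andbF.
move=> l_i; have := leg_mark l; rewrite l_i xpair_eqE andbF /= => ->.
by rewrite /cdist /=; have := ltn_ord j; lia.
Qed.

Lemma vertexP x : (exists w, x = corev w) \/ (exists s, in_region s x).
Proof.
case: x => [[w|s]|[l j]]; [by left; exists w| |]; right.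
  by exists s => /=.
by exists (val l).1 => /=.
Qed.

Lemma dist_core_own l e : e <= 40 ->
  dist (corev (val l).2) (on_leg l e) <= 40 - e.
Proof.
move=> le_e; have le_sub : 40 - e <= 40 by lia.
have := dist_descend (corev (val l).2) l (leqnn 40) le_sub.
by rewrite on_leg_core distxx subKn.
Qed.

(** Seen from [w], a leg with another core end begins at least one step later,
    and the way up from its satellite is longer still. *)
Lemma dist_core_other w l e : (val l).2 != w -> 0 < e <= 40 ->
  41 - e <= dist (corev w) (on_leg l e).
Proof.
move=> ne_w.
(* The core away from [w] and the regions of the other satellites are collapsed
   to one point at distance 1. *)
pose f x : nat :=
  match x with
  | inl (inl v) => v != w
  | inl (inr s) => if s == (val l).1 then 40 else 1
  | inr (l', j) => if (val l').1 == (val l).1 then ((val l').2 != w) + 39 - j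
                   else 1
  end.
have -> : dist (corev w) (on_leg l e) =
    f (corev w) + dist (corev w) (on_leg l e).
  by rewrite /= eqxx.
move=> e_bd; apply: leq_trans (_ : f (on_leg l e) <= _).
  case: e e_bd => // e /andP[_]; rewrite leq_eqVlt => /orP[/eqP[->]|lt_e].
    by rewrite on_leg_core /= ne_w.
  by rewrite (@on_leg_lt _ l e) //= eqxx ne_w; lia.
apply: arc_lipschitz => {e_bd} [[[v|s1]|[l1 j]] [[v'|s2]|[l2 j']]] //=.
- by move=> _; case: (v == w) (v' == w) => [] [].
- by move=> /andP[/eqP-> /eqP->]; case: eqP => // _; case: eqP.
- by move=> /andP[/eqP-> /eqP->]; case: eqP => // _; case: eqP.
by move=> /andP[/eqP-> /eqP->]; case: eqP => // _; case: eqP => _ /=; lia.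
Qed.

End Metric.

(** * Choosing marks coordinate by coordinate *)

Section Choices.

(** The values [a] of a coordinate of the core after two rounds.  The first
    round read [40 + d] from s_{i,0}, one step earlier; the second one read
    [40 + n] from s_{i,0} if [d = 0] and from s_{i,10} otherwise.  Repeating
    the mark 0 when [d = 0] watches the legs that the robber could have
    entered in between.  The first condition is only up to 1 because the robber
    has moved, or because he came from the end of a leg, whose distances exceed
    those of its core end by 1. *)
Definition candidate d n (a : nat) : bool :=
  [&& cdist false a <= d.+1, d <= (cdist false a).+1 & cdist (d != 0) a == n].

Definition candidate_ball d n (a : nat) : bool :=
  has (fun c => candidate d n c && near c a) (iota 0 40).

(** There is at most one candidate, or the candidates are the two neighbours of
    0, 10 or 30.  The mark 10 (encoded by [true]) is needed around 0 and 20,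
    where the distance to 0 does not separate neighbours.  These are the cases
    [d = 0], with the candidate 0 or the candidates 1 and 39, and [n = 10],
    with the candidate 0 or the candidate 20.  The mark 0 suits the others. *)
Definition third_mark d n : bool := (d == 0) || (n == 10).

(** These bounds turn the following lemmas into finite checks. *)
Lemma candidate_bounds d n (a : 'I_40) : candidate d n a -> d < 22 /\ n < 21.
Proof.
case/and3P=> _ le_d /eqP <-; split; last by rewrite ltnS cdist_le.
have := cdist_le false a; lia.
Qed.

Lemma candidate_ballP d n a :
  reflect (exists2 c : 'I_40, candidate d n c & near c a)
          (candidate_ball d n a).
Proof.
apply: (iffP hasP) => [[c]|[c dnc ca]].
  by rewrite mem_iota /= => lt_c /andP[dnc ca]; exists (Ordinal lt_c).
by exists (c : nat); rewrite ?dnc ?ca // mem_iota /= ltn_ord.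
Qed.

Definition all_near a (P : pred nat) : bool :=
  all P (filter (near a) (iota 0 40)).

Lemma all_nearP a P (b : 'I_40) : all_near a P -> near a b -> P b.
Proof.
rewrite /all_near => /allP all_b ab; apply: all_b.
by rewrite mem_filter ab mem_iota /=.
Qed.

Definition all_candidate_ball d n (P : pred nat) : bool :=
  all (fun c => all_near c P) (filter (candidate d n) (iota 0 40)).

Lemma candidate_ball_allP d n P (a : 'I_40) :
  all_candidate_ball d n P -> candidate_ball d n a -> P a.
Proof.
rewrite /all_candidate_ball => /allP all_c /candidate_ballP[c dnc].
have /all_c/all_nearP : (c : nat) \in filter (candidate d n) (iota 0 40).
  by rewrite mem_filter dnc mem_iota /=.
exact.
Qed.

Lemma forall_candidate_ball (P : nat -> nat -> pred nat) :
  all (fun d => all (fun n => all_candidate_ball d n (P d n)) (iota 0 21))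
      (iota 0 22) ->
  forall d n (a : 'I_40), candidate_ball d n a -> P d n a.
Proof.
move=> /allP all_d d n a /[dup].
move=> /candidate_ballP[c /candidate_bounds[lt_d lt_n] _].
have /all_d/allP all_n : d \in iota 0 22 by rewrite mem_iota.
have /all_n : n \in iota 0 21 by rewrite mem_iota.
exact: candidate_ball_allP.
Qed.

Lemma third_mark_inj d n (a b : 'I_40) :
  candidate_ball d n a -> candidate_ball d n b ->
  cdist (third_mark d n) a = cdist (third_mark d n) b -> a = b.
Proof.
move=> dna dnb /eqP eq_ab; apply/val_inj/eqP.
pose P d n a b :=
  (cdist (third_mark d n) a == cdist (third_mark d n) b) ==> (a == b).
have: all (fun d => all (fun n => all_candidate_ball d n (fun a =>
  all_candidate_ball d n (P d n a))) (iota 0 21)) (iota 0 22) by vm_compute.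
move=> /forall_candidate_ball/(_ _ _ _ dna)/candidate_ball_allP/(_ dnb).
by move/implyP; apply.
Qed.

(** Here [b] is the coordinate that a core vertex must have to look like the
    legs over a core vertex with coordinate [a]. *)
Lemma third_mark_far d n (a b : 'I_40) :
  candidate d n a -> candidate_ball d n b ->
  cdist (third_mark d n) b = (cdist (third_mark d n) a).+1 ->
  near a b /\ (marked a -> ~~ marked b).
Proof.
move=> dna dnb /eqP eq_ab.
suff /andP[-> /implyP//] : near a b && (marked a ==> ~~ marked b).
pose P d n b a :=
  (cdist (third_mark d n) b == (cdist (third_mark d n) a).+1) ==>
  near a b && (marked a ==> ~~ marked b).
have: all (fun d => all (fun n => all_candidate_ball d n (fun b =>
  all (P d n b) (filter (candidate d n) (iota 0 40)))) (iota 0 21)) (iota 0 22).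
  by vm_compute.
move=> /forall_candidate_ball/(_ _ _ _ dnb)/allP/(_ a).
by rewrite mem_filter dna mem_iota => /(_ (ltn_ord a))/implyP; apply.
Qed.

(** Here [a] is the coordinate of the core vertex [w] whose legs may hold the
    robber, and [b] that of the only core vertex where he may be.  A marked
    [a] must be watched.  Otherwise the mark 10 is needed for [b] in
    [{0; 20}], where the distance to 0 does not separate the neighbours, and
    for [b = 9], since moving away from 0 would lead to the other mark 10. *)
Definition next_mark (a b : nat) : bool :=
  (a == 10) || (a != 0) && (b \in [:: 0; 9; 20]).

Lemma next_mark_mark a b t : a = mark t :> nat -> next_mark a b = t.
Proof. by move=> ->; case: t. Qed.

Lemma next_mark_inj (a b c c' : 'I_40) :
  near a b -> (marked a -> ~~ marked b) -> near b c -> near b c' ->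
  cdist (next_mark a b) c = cdist (next_mark a b) c' -> c = c'.
Proof.
move=> ab /implyP mab bc bc' /eqP eq_c; apply/val_inj/eqP.
pose P a b c c' :=
  (cdist (next_mark a b) c == cdist (next_mark a b) c') ==> (c == c').
have: all (fun a => all_near a (fun b => (marked a ==> ~~ marked b) ==>
  all_near b (fun c => all_near b (P a b c)))) (iota 0 40) by vm_compute.
move=> /forall_ord40/(_ a)/all_nearP/(_ ab)/implyP/(_ mab).
by move=> /all_nearP/(_ bc)/all_nearP/(_ bc')/implyP; apply.
Qed.

(** The core vertex that cannot be told from the legs over the present one
    carries no leg. *)
Lemma next_mark_far (a b c : 'I_40) :
  near a b -> (marked a -> ~~ marked b) -> near b c ->
  cdist (next_mark a b) c = (cdist (next_mark a b) b).+1 -> ~~ marked c.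
Proof.
move=> ab /implyP mab bc /eqP eq_c.
pose P a b c :=
  (cdist (next_mark a b) c == (cdist (next_mark a b) b).+1) ==> ~~ marked c.
have: all (fun a => all_near a (fun b => (marked a ==> ~~ marked b) ==>
  all_near b (P a b))) (iota 0 40) by vm_compute.
move=> /forall_ord40/(_ a)/all_nearP/(_ ab)/implyP/(_ mab).
by move=> /all_nearP/(_ bc)/implyP; apply.
Qed.

Lemma near_unmarked (a : 'I_40) : exists2 b : 'I_40, near a b & ~~ marked b.
Proof.
have [ma|] := boolP (marked a); last by exists a; rewrite ?near_refl.
exists (ordS a); first by rewrite /near eqxx orbT.
by case/orP: ma => /eqP; rewrite /marked /= => ->.
Qed.

End Choices.

(** * Winning with k cops *)

Section Pursuit.

Variable k : nat.
Implicit Types (w v : core k) (s : satellite k) (l : leg k) (x y : Gk k).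
Implicit Types (A X : {set Gk k}) (T : 'I_k -> bool).

(** A leg of a known satellite is determined by the other coordinates of its
    core end. *)
Lemma leg_inj l l' : (val l).1 = (val l').1 ->
  (forall i, i != (val l).1.1 -> (val l).2 i = (val l').2 i) -> l = l'.
Proof.
move=> eq_s eq_w; apply: val_inj; rewrite [LHS]surjective_pairing eq_s.
rewrite [RHS]surjective_pairing; congr pair; apply/ffunP=> i.
have [->|] := eqVneq i (val l).1.1; last exact: eq_w.
by apply: val_inj; rewrite /= leg_mark eq_s leg_mark.
Qed.

Lemma dist_cell (u : k.-tuple (Gk k)) X x y z i :
  y \in cell u X x -> z \in cell u X x ->
  dist (tnth u i) y = dist (tnth u i) z.
Proof.
rewrite !inE => /andP[_ /eqP y_x] /andP[_ /eqP z_x].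
have := congr1 (fun d => tnth d i) (etrans y_x (esym z_x)).
by rewrite !tnth_mktuple.
Qed.

Lemma cell_refl (u : k.-tuple (Gk k)) X x : x \in X -> x \in cell u X x.
Proof. by move=> xX; rewrite inE xX eqxx. Qed.

Definition satellites T : k.-tuple (Gk k) := [tuple sat (i, T i) | i < k].

Lemma dist_satellites T X x y z i :
  y \in cell (satellites T) X x -> z \in cell (satellites T) X x ->
  dist (sat (i, T i)) y = dist (sat (i, T i)) z.
Proof.
by move=> y_x z_x; have := dist_cell i y_x z_x; rewrite tnth_mktuple.
Qed.

(** The cop of coordinate [s.1] stays on [s] while the others probe the marks
    [T]. *)
Definition follow s T i : bool := if i == s.1 then s.2 else T i.

Lemma tnth_follow s T : tnth (satellites (follow s T)) s.1 = sat s.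
Proof. by rewrite tnth_mktuple /follow eqxx -surjective_pairing. Qed.

Definition legs_of s : {set leg k} := [set l | (val l).1 == s].

Definition level_set (W : {set leg k}) e : {set Gk k} :=
  [set on_leg l e | l in W].

(** A cop on [s] reads the level exactly, so only the choice of the leg remains
    unknown after the probe. *)
Lemma cell_level s (W : {set leg k}) e (u : k.-tuple (Gk k)) x :
  W \subset legs_of s -> 0 < e < 40 -> tnth u s.1 = sat s ->
  x \in nbh (level_set W e) ->
  exists e', [/\ e' <= e.+1, e <= e'.+1 &
    cell u (nbh (level_set W e)) x \subset
      level_set [set l in W | on_leg l e' \in cell u (nbh (level_set W e)) x] e'].
Proof.
move=> /subsetP W_s e_bd u_s; set X := nbh _.
have legP y : y \in X -> exists l e',
    [/\ l \in W, y = on_leg l e', e' <= e.+1, e <= e'.+1 & dist (sat s) y = e'].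
  move=> /nbhP[_ /imsetP[l lW ->]] /step_internal - /(_ e_bd)[e' -> [le1 le2]].
  exists l, e'; split=> //; have /eqP <- : (val l).1 == s.
    by have := W_s l lW; rewrite inE.
  by rewrite dist_own //; lia.
move=> xX; have [l [e' [lW _ le1 le2 dist_x]]] := legP x xX.
exists e'; split=> //; apply/subsetP=> y y_cell.
have yX : y \in X by move: y_cell; rewrite inE => /andP[].
have [l' [e1 [l'W def_y _ _ dist_y]]] := legP y yX.
have eq_e : e1 = e'.
  by rewrite -dist_y -dist_x -u_s; apply: dist_cell y_cell (cell_refl u xX).
by apply/imsetP; exists l'; rewrite -eq_e // inE l'W -def_y.
Qed.

Lemma dist_leg_other s l i t e : l \in legs_of s -> i != s.1 -> 10 <= e <= 40 ->
  dist (sat (i, t)) (on_leg l e) = 80 - e + cdist t ((val l).2 i).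
Proof.
rewrite inE => /eqP l_s ne_i e_bd; rewrite dist_other // l_s.
by apply: contra ne_i => /eqP<-.
Qed.

(** The previous probe gave the distances to the marks [T]; probing the opposite
    marks determines all coordinates of the core end.  The bound on [e] keeps
    the robber on levels where [dist_other] applies. *)
Lemma wins_two_sides s T e (W : {set leg k}) : 10 < e < 40 ->
  W \subset legs_of s ->
  {in W &, forall l l', forall i, i != s.1 ->
    cdist (T i) ((val l).2 i) = cdist (T i) ((val l').2 i)} ->
  wins k (nbh (level_set W e)).
Proof.
move=> e_bd W_s W_T; pose T' := follow s (fun i => ~~ T i).
apply: (@wins_probe _ _ (satellites T')) => x xX; left.
have e_bd' : 0 < e < 40 by lia.
have [e' [le1 le2]] := cell_level W_s e_bd' (tnth_follow s (fun i => ~~ T i)) xX.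
have e'_bd : 10 <= e' <= 40 by lia.
set C := cell _ _ _; set W' := [set l in W | _] => /subsetP C_W'.
have W'P l : l \in W' -> [/\ l \in W, l \in legs_of s & on_leg l e' \in C].
  by rewrite inE => /andP[lW ->]; split=> //; apply: (subsetP W_s).
apply/card_le1_eqP => y y' /C_W'/imsetP[l /W'P[lW l_s lC] ->].
move=> /C_W'/imsetP[l' /W'P[l'W l'_s l'C] ->]; apply/esym.
congr on_leg; apply: leg_inj => [|i].
  by move: l_s l'_s; rewrite !inE => /eqP-> /eqP->.
have -> : (val l).1.1 = s.1 by move: l_s; rewrite inE => /eqP->.
move=> ne_i; apply: (@cdist_inj (T i)); first exact: W_T.
have := dist_satellites i lC l'C; rewrite /T' /follow (negbTE ne_i).
by rewrite !(dist_leg_other _ _ ne_i e'_bd) // => /addnI.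
Qed.

(** Probing any marks in the other coordinates prepares [wins_two_sides]; the
    robber cannot have reached the core in between. *)
Lemma wins_inside s e (W : {set leg k}) : 11 < e < 39 -> W \subset legs_of s ->
  wins k (nbh (level_set W e)).
Proof.
move=> e_bd W_s; pose T := follow s xpred0.
apply: (@wins_probe _ _ (satellites T)) => x xX; right.
have e_bd' : 0 < e < 40 by lia.
have [e' [le1 le2]] := cell_level W_s e_bd' (tnth_follow s xpred0) xX.
have e'_bd : 10 <= e' <= 40 by lia.
move=> /nbhS C_W; apply: wins_sub C_W _; set C := cell _ _ _.
set W' := [set l in W | _].
have W'P l : l \in W' -> l \in legs_of s /\ on_leg l e' \in C.
  by rewrite inE => /andP[lW ->]; split=> //; apply: (subsetP W_s).
apply: (@wins_two_sides s T); first lia.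
  by apply/subsetP=> l /W'P[].
move=> l l' /W'P[l_s lC] /W'P[l'_s l'C] i ne_i.
have := dist_satellites i lC l'C.
by rewrite !(dist_leg_other _ _ ne_i e'_bd) // => /addnI.
Qed.

(** Near the satellite the distances do not reveal the other coordinates: the
    shortest way from another satellite may come down to [s] first.  Instead,
    the other cops probe the core end of a leg [l0], which tells whether the
    robber is on [l0]; each round without capture removes one leg, unless the
    robber climbs to level 12, where [wins_inside] takes over.  Changing the leg
    would lead through the satellite, where he is caught. *)
Lemma wins_low s e (W : {set leg k}) : 0 < e < 12 -> W \subset legs_of s ->
  wins k (nbh (level_set W e)).
Proof.
have [n] := ubnP #|W|; elim: n => // n IHn in W e *; rewrite ltnS => le_W e_bd W_s.
have e_bd' : 0 < e < 40 by lia.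
have s_of l : l \in W -> (val l).1 = s by move/(subsetP W_s); rewrite inE => /eqP.
have [W1|W2] := leqP #|W| 1.
  apply: (@wins_probe _ _ (satellites (follow s xpred0))) => x xX; left.
  have [e' [_ _ C_W]] := cell_level W_s e_bd' (tnth_follow s xpred0) xX.
  apply: leq_trans (subset_leq_card C_W) _.
  apply: leq_trans (leq_imset_card _ _) _.
  apply: leq_trans W1; apply/subset_leq_card/subsetP=> l.
  by rewrite inE => /andP[].
have /card_gt1P[l0 [l1 [l0W l1W ne_l]]] := W2.
have [i0 ne_i0] : exists i, i != s.1.
  apply/existsP; apply: contraNT ne_l; rewrite negb_exists => /forallP all_s.
  apply/eqP/leg_inj; first by rewrite !s_of.
  by move=> i; rewrite s_of // (negPf (all_s i)).
pose w0 := (val l0).2.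
pose u : k.-tuple (Gk k) := [tuple if i == s.1 then sat s else corev w0 | i < k].
have u_s : tnth u s.1 = sat s by rewrite tnth_mktuple eqxx.
have u_i0 : tnth u i0 = corev w0 by rewrite tnth_mktuple (negPf ne_i0).
apply: (@wins_probe _ _ u) => x xX.
have [e' [le1 le2 C_W]] := cell_level W_s e_bd' u_s xX.
have [e0|e'_gt0] := posnP e'.
  left; apply: leq_trans (subset_leq_card C_W) _; rewrite e0.
  apply: (@leq_trans #|[set sat s]|); last by rewrite cards1.
  apply/subset_leq_card/subsetP=> y /imsetP[l]; rewrite !inE => /andP[lW _] ->.
  by rewrite -(s_of l lW).
have le_e' : e' <= 40 by clear -le1 e_bd; lia.
have e'_bd : 0 < e' <= 40 by rewrite e'_gt0.
have [lt12|ge12] := ltnP e' 12; last first.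
  right; apply: wins_sub (nbhS C_W) _; apply: (@wins_inside s).
    by clear -ge12 le1 e_bd; lia.
  by apply/subsetP=> l; rewrite inE => /andP[/(subsetP W_s)].
set C := cell _ _ _ in C_W *.
have same_leg l : l \in W -> (val l).2 = w0 -> l = l0.
  move=> lW l_w0; apply: leg_inj; first by rewrite !s_of.
  by move=> i _; rewrite l_w0.
have [l0C|l0C] := boolP (on_leg l0 e' \in C).
  left; apply/card_le1_eqP.
  suff C_l0 y : y \in C -> y = on_leg l0 e' by move=> y z /C_l0-> /C_l0->.
  move=> yC; have /imsetP[l] := subsetP C_W y yC.
  rewrite inE => /andP[lW _] def_y; rewrite def_y.
  have [/same_leg->//|ne_w0] := eqVneq (val l).2 w0.
  have := dist_cell i0 yC l0C; rewrite u_i0 def_y => eq_d.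
  have := dist_core_other ne_w0 e'_bd; rewrite eq_d => ge_d.
  by have := leq_trans ge_d (dist_core_own l0 le_e'); rewrite subSn // ltnn.
right; apply: wins_sub (nbhS C_W) _; set W' := [set l in W | _].
have W'W : W' \subset W by apply/subsetP=> l; rewrite inE => /andP[].
apply: IHn; [|by rewrite e'_gt0|exact: subset_trans W_s].
apply: leq_trans le_W; apply: proper_card; rewrite properE W'W.
by apply/subsetPn; exists l0; rewrite // inE negb_and l0C orbT.
Qed.

(** A robber on a high level when first seen could reach the core at once, but
    then the round in which he was seen already gave the distances to the
    marks [T] in the other coordinates. *)
Lemma wins_seen T i X x : x \in X -> in_region (i, T i) x ->
  let C := cell (satellites T) X x in #|C| <= 1 \/ wins k (nbh C).
Proof.
set s := (i, T i) => xX; rewrite region_dist => lt_x C.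
have xC := cell_refl (satellites T) xX.
set e := dist (sat s) x in lt_x.
have C_s y : y \in C ->
    exists l, [/\ l \in legs_of s, y = on_leg l e & on_leg l e \in C].
  move=> yC; have dist_y : dist (sat s) y = e by apply: dist_satellites i yC xC.
  have /in_regionP[l [e' [l_s lt_e def_y]]] : in_region s y.
    by rewrite region_dist dist_y.
  have eq_e : e' = e by rewrite -dist_y -l_s def_y dist_own // ltnW.
  by exists l; rewrite inE l_s eqxx -eq_e -def_y.
pose W := [set l in legs_of s | on_leg l e \in C].
have W_s : W \subset legs_of s by apply/subsetP=> l; rewrite inE => /andP[].
have C_W : C \subset level_set W e.
  apply/subsetP=> y /C_s[l [l_s -> lC]]; apply: imset_f.
  by rewrite in_set l_s.
have [e0|e_gt0] := posnP e.
  left; apply/card_le1_eqP.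
  suff C_sat y : y \in C -> y = sat s by move=> y z /C_sat-> /C_sat->.
  by case/C_s=> l []; rewrite inE e0 => /eqP<- ->.
right; apply: wins_sub (nbhS C_W) _.
have [lt12|ge12] := ltnP e 12; first by apply: (@wins_low s) => //; lia.
apply: (@wins_two_sides s T) => //; first lia.
move=> l l'; rewrite ![_ \in W]inE => /andP[l_s lC] /andP[l'_s l'C] j ne_j.
have := dist_satellites j lC l'C.
have e_bd : 10 <= e <= 40 by rewrite (ltnW lt_x) andbT ltnW // ltnW.
by rewrite !(dist_leg_other _ _ ne_j e_bd) // => /addnI.
Qed.

(** As [wins_seen] settles the other results, only those without a distance
    below 40 need attention. *)
Lemma wins_satellites T X :
  (forall x, x \in X -> let C := cell (satellites T) X x in
     {in C, forall y, forall i, ~~ in_region (i, T i) y} ->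
     #|C| <= 1 \/ wins k (nbh C)) ->
  wins k X.
Proof.
move=> unseen; apply: (@wins_probe _ _ (satellites T)) => x xX.
set C := cell _ _ _.
have [/exists_inP[y yC /existsP[i y_i]]|] :=
  boolP [exists y in C, [exists i, in_region (i, T i) y]].
  have yX : y \in X by move: yC; rewrite inE => /andP[].
  have -> : C = cell (satellites T) X y; last exact: wins_seen y_i.
  move: yC; rewrite inE => /andP[_ /eqP eq_d].
  by apply/setP=> z; rewrite !inE eq_d.
rewrite negb_exists_in => /forall_inP none; apply: unseen => // y yC i.
by have := none y yC; rewrite negb_exists => /forallP.
Qed.

(** What stays possible for an unseen robber after a round: he is at [y], or he
    has just stepped from [w] onto a leg. *)
Definition shadow w (y : core k) : {set Gk k} :=
  corev y |: [set on_leg l 39 | l : leg k & (val l).2 == w].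

(** Suppose that the chosen marks separate the possible core positions, and that
    [P] holds for the core vertices from which the robber may have just stepped
    onto an unwatched leg.  All legs over one core vertex [w] look alike, and
    they look like the core vertex (if any) which is farther than [w] by 1 from
    every chosen mark; legs over distinct core vertices look different. *)
Lemma wins_resolve T (B : 'I_k -> pred 'I_40) (P : core k -> Prop) X :
  (forall i a b, B i a -> B i b -> cdist (T i) a = cdist (T i) b -> a = b) ->
  (forall w, P w -> forall i, B i (w i)) ->
  (forall x, x \in X -> [\/ exists2 w, x = corev w & forall i, B i (w i),
     exists i, in_region (i, T i) x | exists2 l, x = on_leg l 39 & P (val l).2]) ->
  (forall w, P w -> exists y : core k,
     (forall v : core k, (forall i, B i (v i)) ->
        (forall i, cdist (T i) (v i) = (cdist (T i) (w i)).+1) -> v = y) /\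
     wins k (nbh (shadow w y))) ->
  wins k X.
Proof.
move=> B_inj P_B X_shape P_wins; apply: (@wins_satellites T) => x xX C unseen.
have C_shape z : z \in C -> (exists2 v, z = corev v & forall i, B i (v i)) \/
    exists2 l, z = on_leg l 39 & P (val l).2.
  move=> zC; have : z \in X by move: zC; rewrite inE => /andP[].
  case/X_shape=> [|[i z_i]|]; [by left | | by right].
  by have := unseen z zC i; rewrite z_i.
have far l i : on_leg l 39 \in C ->
    dist (sat (i, T i)) (on_leg l 39) = 41 + cdist (T i) ((val l).2 i).
  move=> /unseen/(_ i) out_l; rewrite dist_other //.
  by apply: contraNneq out_l => ->; rewrite (@on_leg_lt _ l 38) //= eqxx.
have same v v' : (forall i, B i (v i)) -> (forall i, B i (v' i)) ->
    (forall i, cdist (T i) (v i) = cdist (T i) (v' i)) -> v = v'.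
  by move=> vB v'B eq_v; apply/ffunP=> i; apply: B_inj (eq_v i).
case: (pickP (fun l : leg k => on_leg l 39 \in C)) => [l lC|no_leg]; last first.
  left; apply/card_le1_eqP.
  have core_C z : z \in C -> exists2 v, z = corev v & forall i, B i (v i).
    move=> zC; case: (C_shape z zC) => // -[l def_z].
    by have := no_leg l; rewrite -def_z zC.
  move=> z z' zC z'C; have [v def_z vB] := core_C z zC.
  have [v' def_z' v'B] := core_C z' z'C.
  rewrite def_z def_z'; congr corev; apply: same => // i.
  have := dist_satellites i zC z'C; rewrite def_z def_z' !dist_core.
  by move/addnI.
have Pl : P (val l).2.
  case: (C_shape _ lC) => [[v]|[l']]; first by rewrite (@on_leg_lt _ l 38).
  by rewrite (@on_leg_lt _ l 38) // (@on_leg_lt _ l' 38) // => -[->].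
have [y [y_uniq y_wins]] := P_wins _ Pl.
right; apply: wins_sub (nbhS _) y_wins; apply/subsetP=> z zC.
have [[v def_z vB]|[l' def_z Pl']] := C_shape z zC; rewrite inE; apply/orP.
  left; rewrite inE def_z; apply/eqP; congr corev; apply: y_uniq => // i.
  have := dist_satellites i zC lC; rewrite def_z dist_core far //=.
  by rewrite -[41]/(40 + 1) -addnA => /addnI.
right; rewrite def_z; apply: imset_f; rewrite inE; apply/eqP; apply: same.
- exact: P_B.
- exact: P_B.
by move=> i; have := dist_satellites i zC lC; rewrite def_z !far -?def_z // => /addnI.
Qed.

Lemma near_unmarked_core w :
  exists2 y : core k, forall i, near (w i) (y i) & forall i, ~~ marked (y i).
Proof.
have /fin_all_exists[f fP] (i : 'I_k) :
    exists b : 'I_40, near (w i) b && ~~ marked b.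
  by have [b wb mb] := near_unmarked (w i); exists b; rewrite wb.
by exists [ffun i => f i] => i; rewrite ffunE; have /andP[] := fP i.
Qed.

(** The legs over [w] are watched, because [next_mark] respects a marked
    coordinate of [w].  New legs are available only over [y], and only if [y]
    has a marked coordinate. *)
Lemma wins_shadow_step w (y : core k) :
  (forall i, near (w i) (y i)) -> (forall i, marked (w i) -> ~~ marked (y i)) ->
  ((exists i, marked (y i)) ->
     forall y' : core k, (forall i, near (y i) (y' i)) ->
       (forall i, ~~ marked (y' i)) -> wins k (nbh (shadow y y'))) ->
  wins k (nbh (shadow w y)).
Proof.
move=> wy mwy next; pose T i := next_mark (w i) (y i).
apply: (@wins_resolve T (fun i a => near (y i) a)
  (fun v => v = y /\ exists i, marked (y i))).
- by move=> i a b; apply: next_mark_inj (wy i) (mwy i).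
- by move=> _ [-> _] i; apply: near_refl.
- move=> x /nbhP[x0]; rewrite inE => /orP[]; last first.
    move=> /imsetP[l]; rewrite inE => /eqP l_w ->.
    move=> /step_internal[] // e' -> [le1 le2].
    have := ltnP e' 40 => -[lt_e|ge_e]; last first.
      have -> : e' = 40 by lia.
      by apply: Or31; exists w; rewrite ?on_leg_core ?l_w // => i; rewrite near_sym.
    apply: Or32; exists (val l).1.1; apply/in_regionP; exists l, e'; split=> //.
    rewrite [LHS]surjective_pairing; congr pair; apply/esym/next_mark_mark.
    by rewrite -l_w leg_mark.
  rewrite inE => /eqP-> /step_out_of_core[[v -> yv]|[l -> l_y]].
    by apply: Or31; exists v.
  apply: Or33; exists l => //; split=> //; exists (val l).1.1.
  by rewrite -l_y leg_mark; case: (val l).1.2.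
move=> _ [-> my].
pose away (v : core k) := [forall i, near (y i) (v i)] &&
  [forall i, cdist (T i) (v i) == (cdist (T i) (y i)).+1].
have [v /andP[/forallP yv /forallP far_v]|none] := pickP away; last first.
  have [y' yy' my'] := near_unmarked_core y; exists y'; split; last exact: next.
  move=> v yv far_v; have := none v; rewrite /away.
  have -> : [forall i, near (y i) (v i)] by apply/forallP.
  by case: forallP => // -[] i; apply/eqP.
exists v; split.
  move=> v' yv' far_v'; apply/ffunP=> i.
  by apply: (next_mark_inj (wy i) (mwy i)) => //; rewrite far_v' (eqP (far_v i)).
apply: next => // i; apply: (next_mark_far (wy i) (mwy i)) => //.
exact/eqP/far_v.
Qed.

(** After one step the core vertex has no marked coordinate, and the second step
    is final. *)
Lemma wins_shadow w (y : core k) :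
  (forall i, near (w i) (y i)) -> (forall i, marked (w i) -> ~~ marked (y i)) ->
  wins k (nbh (shadow w y)).
Proof.
move=> wy mwy; apply: wins_shadow_step => // my y' yy' my'.
by apply: wins_shadow_step => // [[i]]; rewrite (negbTE (my' i)).
Qed.

(** By [third_mark_far] a core vertex that looks like the legs over [w]
    satisfies the assumptions of [wins_shadow]; if there is none, any unmarked
    vertex near [w] can take its place. *)
Lemma wins_third (d n : 'I_k -> nat) A :
  {in A, forall x,
     exists2 w, x = corev w & forall i, candidate (d i) (n i) (w i)} ->
  wins k (nbh A).
Proof.
move=> A_core; pose T i := third_mark (d i) (n i).
apply: (@wins_resolve T (fun i a => candidate_ball (d i) (n i) a)
  (fun w => forall i, candidate (d i) (n i) (w i))).
- by move=> i a b; apply: third_mark_inj.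
- by move=> w wA i; apply/candidate_ballP; exists (w i); rewrite ?near_refl.
- move=> x /nbhP[_ /A_core[w -> wA]] /step_out_of_core[[v -> wv]|[l -> l_w]].
    by apply: Or31; exists v => // i; apply/candidate_ballP; exists (w i).
  by apply: Or33; exists l; rewrite // l_w.
move=> w wA.
pose away (v : core k) := [forall i, candidate_ball (d i) (n i) (v i)] &&
  [forall i, cdist (T i) (v i) == (cdist (T i) (w i)).+1].
have [v /andP[/forallP vB /forallP far_v]|none] := pickP away; last first.
  have [y wy my] := near_unmarked_core w; exists y; split; last exact: wins_shadow.
  move=> v vB far_v; have := none v; rewrite /away.
  have -> : [forall i, candidate_ball (d i) (n i) (v i)] by apply/forallP.
  by case: forallP => // -[] i; apply/eqP.
have wv i : near (w i) (v i) /\ (marked (w i) -> ~~ marked (v i)).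
  by apply: third_mark_far (wA i) (vB i) _; apply/eqP/far_v.
exists v; split; last by apply: wins_shadow => i; case: (wv i).
move=> v' v'B far_v'; apply/ffunP=> i.
by apply: (third_mark_inj (v'B i) (vB i)); rewrite far_v' (eqP (far_v i)).
Qed.

(** The first round probes all s_{i,0}; let [40 + d i] be its results, which
    are at least 40 for an unseen robber.  In the second round a robber in the
    region of s_{i,0} has just come from the core, so [d i = 0], whereas one in
    the region of s_{i,10} is so far from s_{i,0} that [d i] is positive.  Both
    are seen by the probe chosen according to [d]. *)
Lemma wins_Gk : wins k [set: Gk k].
Proof.
apply: (@wins_satellites xpred0) => x _ C C_unseen; right.
have ge40 y i : y \in C -> 40 <= dist (sat (i, false)) y.
  by move=> yC; rewrite leqNgt -region_dist C_unseen.
case: (set_0Vmem C) => [->|[x0 x0C]].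
  apply: (@wins_sub _ _ _ set0); last by exists 1; apply/existsP;
    exists (satellites xpred0); apply/forall_inP=> y; rewrite inE.
  by apply/subsetP=> y /nbhP[z]; rewrite inE.
pose d i := dist (sat (i, false)) x0 - 40.
have dC y i : y \in C -> dist (sat (i, false)) y = 40 + d i.
  move=> yC; rewrite /d subnKC; last exact: ge40.
  exact: dist_satellites i yC x0C.
have near_C y : y \in nbh C -> forall i,
    dist (sat (i, false)) y <= 41 + d i /\
    40 + d i <= (dist (sat (i, false)) y).+1.
  move=> /nbhP[z zC zy] i; rewrite -(dC z i zC).
  have := dist_step (@Gk_connected k) (sat (i, false)) zy; rewrite (dC z i zC).
  rewrite robber_step_sym in zy.
  have := dist_step (@Gk_connected k) (sat (i, false)) zy; rewrite (dC z i zC).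
  by split.
apply: (@wins_satellites (fun i => d i != 0)) => y yC C2 C2_unseen; right.
have C2_nbh z : z \in C2 -> z \in nbh C by rewrite inE => /andP[].
have yC2 : y \in C2 by apply: cell_refl.
pose n i := dist (sat (i, d i != 0)) y - 40.
apply: (@wins_third d n) => z zC2.
have zC := near_C z (C2_nbh z zC2).
case: (vertexP z) => [[w def_z]|[[i t] z_i]].
  exists w => // i; have := zC i; rewrite def_z dist_core /= => -[le1 le2].
  apply/and3P; split; [lia | lia |].
  rewrite /n -(dist_satellites i zC2 yC2) def_z dist_core.
  by rewrite addKn.
have [le1 le2] := zC i; have := C2_unseen z zC2 i.
case: t z_i => z_i.
  have := region_far z_i => far_z; have -> : d i != 0 by lia.
  by rewrite z_i.
have := z_i; rewrite region_dist => lt_z; have -> : d i = 0 by lia.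
by rewrite z_i.
Qed.

Lemma localization_Gk : 0 < k -> is_localization_number (Gk k) k.
Proof.
move=> k_gt0; split=> //; first exact: cops_win_of_wins wins_Gk.
by move=> m _; apply: contraPT; rewrite -ltnNge; apply: Gk_lower_bound.
Qed.

End Pursuit.

Theorem theorem2p4 (k : nat) (k_gt0 : 0 < k) :
  degeneracy (Gk k) = 3 ^ k - 1 /\ is_localization_number (Gk k) k.
Proof. by split; [apply: degeneracy_Gk | apply: localization_Gk]. Qed.
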